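(* Let $(S_t)_{t\ge 0}$ be a subordinator with Bernstein function $\phi$ and let $f:(0,\infty)\to[0,\infty)$ be a measurable function. The following assertions are equivalent: (i) $\mathbb{P}\left(\int_0^\infty f(t)\,dS_t<\infty\right)>0$; (ii) $\mathbb{P}\left(\int_0^\infty f(t)\,dS_t<\infty\right)=1$; (iii) $\int_0^\infty \phi(f(t))\,dt<\infty$.
   Context: A subordinator $(S_t)_{t\ge0}$ is an increasing càdlàg Lévy process on $[0,\infty)$ with $S_0=0$. Its Bernstein function $\phi:(0,\infty)\to(0,\infty)$ is determined by $\mathbb{E}[e^{-rS_t}]=e^{-t\phi(r)}$ for $r>0$, $t\ge0$; it has the form $\phi(r)=br+\int_{(0,\infty)}(1-e^{-rs})\,\nu(ds)$ with drift $b\ge0$ and Lévy measure $\nu$ on $(0,\infty)$ satisfying $\int_{(0,\infty)}(1\wedge s)\,\nu(ds)<\infty$. One sets $\phi(0):=\phi(0+)=0$. The integral $\int_0^\infty f(t)\,dS_t\in[0,\infty]$ is the pathwise Lebesgue–Stieltjes integral over $(0,\infty)$. *)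

(* Defs.v *)
From HB Require Import structures.
From mathcomp Require Import all_boot all_order all_algebra.
From mathcomp Require Import all_classical all_reals all_analysis.

Set Implicit Arguments.
Unset Strict Implicit.
Unset Printing Implicit Defensive.

Import Order.TTheory GRing.Theory Num.Theory.
Import numFieldNormedType.Exports.

Local Open Scope classical_set_scope.
Local Open Scope ring_scope.

(* For a finite family, the product rule for every subfamily follows from the
   product rule for the whole family, by taking B i = setT. *)
Definition mutually_independent (d : measure_display) (T : measurableType d)
    (R : realType) (P : probability T R) (n : nat)
    (X : 'I_n -> T -> R) : Prop :=
  forall B : 'I_n -> set R, (forall i, measurable (B i)) ->
    (P (\bigcap_(i in [set: 'I_n]) (X i @^-1` B i)) =
     \prod_(i < n) P (X i @^-1` B i))%E.

(* A process (S_t)_(t >= 0) is indexed by all of R; every notion below only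
   looks at the times t >= 0, so its values at negative times are junk. *)

Definition cadlag (R : realType) (x : R -> R) : Prop :=
  (forall t, 0 <= t -> x s @[s --> t^'+] --> x t) /\
  (forall t, 0 < t -> cvg (x s @[s --> t^'-])).

Record levy_process (d : measure_display) (T : measurableType d)
    (R : realType) (P : probability T R) (S : R -> {RV P >-> R}) : Prop :=
  LevyProcess {
    levy_start : forall w, S 0 w = 0 ;
    levy_cadlag : forall w, cadlag (fun t => S t w) ;
    levy_independent_increments : forall (n : nat) (t : nat -> R),
      0 <= t 0%N -> (forall i, (i < n)%N -> t i <= t i.+1) ->
      mutually_independent P (fun (i : 'I_n) w => S (t i.+1) w - S (t i) w) ;
    levy_stationary_increments : forall (s h : R) (B : set R),
      0 <= s -> 0 <= h -> measurable B ->
      P ((fun w => S (s + h) w - S s w) @^-1` B) = P (S h @^-1` B) }.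

Record subordinator (d : measure_display) (T : measurableType d)
    (R : realType) (P : probability T R) (S : R -> {RV P >-> R}) : Prop :=
  Subordinator {
    subordinator_levy : levy_process S ;
    subordinator_nondecreasing : forall w (s t : R),
      0 <= s -> s <= t -> S s w <= S t w }.

(* The Levy-Khintchine form phi(r) = b r + \int (1 - e^(- r s)) nu(ds) is a
   consequence of these conditions, and so is phi(0+) = 0. *)
Record bernstein_function_of (d : measure_display) (T : measurableType d)
    (R : realType) (P : probability T R) (S : R -> {RV P >-> R})
    (phi : R -> R) : Prop :=
  BernsteinFunctionOf {
    bernstein_gt0 : forall r, 0 < r -> 0 < phi r ;
    bernstein_laplace : forall r t, 0 < r -> 0 <= t ->
      ('E_P[fun w => expR (- r * S t w)] = (expR (- t * phi r))%:E)%E ;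
    bernstein_at0 : phi 0 = 0 }.

Section path.
Context (d : measure_display) (T : measurableType d) (R : realType).
Context (P : probability T R) (S : R -> {RV P >-> R}).

(* The path of S, extended to negative times by S_0 (= 0), so that it is a
   distribution function on R. *)
Definition path0 (w : T) (t : R) : R := S (Num.max 0 t) w.

Hypothesis HS : subordinator S.

Lemma path0_nondecreasing w : nondecreasing (path0 w).
Proof.
move=> s t st; apply: (subordinator_nondecreasing HS).
  by rewrite le_max lexx.
by rewrite ge_max !le_max lexx st /= orbT.
Qed.

Lemma path0_right_continuous w : right_continuous (path0 w).
Proof.
have [rc _] := levy_cadlag (subordinator_levy HS) w.
move=> t; have [t0|t0] := leP 0 t.
  have -> : path0 w t = S t w by rewrite /path0 (max_idPr t0).
  apply: cvg_trans (rc t t0); apply: near_eq_cvg.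
  near=> s; rewrite /path0 (max_idPr _)//; apply: (le_trans t0).
  by near: s; exact: nbhs_right_ge.
have -> : path0 w t = S 0 w by rewrite /path0 (max_idPl (ltW t0)).
have c0 : S 0 w @[_ --> t^'+] --> S 0 w by exact: cvg_cst.
apply: cvg_trans c0; apply: near_eq_cvg.
near=> s; rewrite /path0 (max_idPl _)//; apply: ltW.
by near: s; exact: nbhs_right_lt.
Unshelve. all: by end_near. Qed.

Definition path_cumulative (w : T) : cumulative R R :=
  HB.pack (path0 w)
    (isCumulative.Build _ _ _ (path0 w) (@path0_nondecreasing w)
       (@path0_right_continuous w)).

Definition stieltjes_integral (f : R -> R) (w : T) : \bar R :=
  (\int[lebesgue_stieltjes_measure (path_cumulative w)]_(t in `]0%R, +oo[)
     (f t)%:E)%E.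

End path.

(* Main.v *)
Require Import Defs.
From HB Require Import structures.
From mathcomp Require Import all_boot all_order all_algebra.
From mathcomp Require Import all_classical all_reals all_analysis.
From mathcomp Require Import measurable_realfun.

Set Implicit Arguments.
Unset Strict Implicit.
Unset Printing Implicit Defensive.

Import Order.TTheory GRing.Theory Num.Theory.
Import numFieldNormedType.Exports.

Local Open Scope classical_set_scope.
Local Open Scope ring_scope.

(** The proof rests on one identity, the Laplace functional of the random
measure [dS]: for every measurable [f >= 0],

  E[exp (- int_(0,oo) f dS)] = exp (- int_(0,oo) phi (f t) dt),

with the convention [exp (- oo) = 0] on both sides
([laplace_stieltjes_integral]).  Write [I(f)] for the integral of [f] against
[dS] and [Phi(f)] for the integral of [phi o f].

If [Phi(f) = oo], the identity says that [exp (- I(f))], which is nonnegative,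
has zero mean; hence [I(f) = oo] almost surely ([finite_event_gt0]).  If
[Phi(f)] is finite, apply the identity to [f / k]: as [I(f / k)] is infinite
together with [I(f)], P(I(f) < oo) >= E[exp (- I(f / k))] = exp (- Phi(f / k)),
and [Phi(f / k)] tends to [0] because [phi] is nondecreasing and continuous
with [phi 0 = 0] ([finite_event_eq1]).

The identity is proved in three stages.  For a step function on a grid it is
the independence and the stationarity of the increments
([laplace_formula_grid]).  On a bounded time window and for functions with
values in a fixed interval [0, C], all three integrals involved (against [dS]
for a fixed path, against the probability, and against Lebesgue measure) pass to
pointwise limits by dominated convergence ([laplace_formula_cvg]).  A continuous
function is a pointwise limit of step functions, and every Borel function is
obtained from continuous ones by iterated pointwise limits
([baire_measurable]), so the identity reaches every truncated measurable
function ([laplace_formula_clamp]).  Going through limits of functions, and not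
through a pi-lambda argument on sets, matters: the identity is not linear in
[f], so that the sets satisfying it are not visibly stable under differences.
Finally the window and the truncation level grow to infinity, by monotone
convergence.  The same limits show that [I(f)] is measurable in the
sample point, without which its probabilities would be meaningless. *)

(** * Limits of truncated and of bounded functions *)

Section cvg_minmax.
Context (R : realType) (I : Type) (F : set_system I) (FF : Filter F).
Implicit Types (u v : I -> R) (a b : R).

Lemma cvg_minr u v a b : u x @[x --> F] --> a -> v x @[x --> F] --> b ->
  Num.min (u x) (v x) @[x --> F] --> Num.min a b.
Proof.
move=> ua vb; rewrite minr_absE; under eq_fun do rewrite minr_absE.
apply: cvgM; last exact: cvg_cst.
by apply: cvgB; [exact: cvgD|apply: cvg_norm; exact: cvgB].
Qed.

Lemma cvg_maxr u v a b : u x @[x --> F] --> a -> v x @[x --> F] --> b ->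
  Num.max (u x) (v x) @[x --> F] --> Num.max a b.
Proof.
move=> ua vb; rewrite maxr_absE; under eq_fun do rewrite maxr_absE.
apply: cvgM; last exact: cvg_cst.
by apply: cvgD; [exact: cvgD|apply: cvg_norm; exact: cvgB].
Qed.

End cvg_minmax.

Section clamp.
Context (R : realType).

(** The absolute value makes the truncation map all of the real line to [0, C],
so that it can be composed with functions of any sign. *)
Definition clamp (C x : R) := Num.min `|x| C.

Lemma clamp_itv (C x : R) : 0 <= C -> 0 <= clamp C x <= C.
Proof. by move=> C0; rewrite /clamp le_min normr_ge0 C0 ge_min lexx orbT. Qed.

Lemma clamp_cvg (I : Type) (F : set_system I) (FF : Filter F) (C : R)
    (u : I -> R) a : u x @[x --> F] --> a ->
  clamp C (u x) @[x --> F] --> clamp C a.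
Proof. by move=> ua; apply: cvg_minr; [exact: cvg_norm|exact: cvg_cst]. Qed.

Lemma measurable_clamp (C : R) : measurable_fun setT (clamp C).
Proof. by apply: measurable_minr => //; exact: measurable_normr. Qed.

End clamp.

Section bounded_convergence.
Context d (T : measurableType d) (R : realType).
Context (mu : {measure set T -> \bar R}) (D : set T).
Hypotheses (mD : measurable D) (muD : (mu D < +oo)%E).

Lemma bounded_integrable (g : T -> R) (C : R) : measurable_fun D g ->
  (forall x, D x -> `|g x| <= C) -> mu.-integrable D (EFin \o g).
Proof.
move=> mg gC; apply: measurable_bounded_integrable => //.
exists C; split; first by rewrite num_real.
by move=> y Cy x Dx /=; rewrite (le_trans (gC _ Dx))// ltW.
Qed.

Lemma bounded_cvg_Rintegral (g_ : nat -> T -> R) (g : T -> R) (C : R) :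
  (forall n, measurable_fun D (g_ n)) ->
  (forall n x, D x -> `|g_ n x| <= C) ->
  (forall x, D x -> g_ n x @[n --> \oo] --> g x) ->
  \int[mu]_(x in D) g_ n x @[n --> \oo] --> \int[mu]_(x in D) g x.
Proof.
move=> mg gC g_g.
have mlim : measurable_fun D g by exact: measurable_fun_cvg mg _.
have [] := @dominated_convergence _ _ _ mu D mD
  (fun n x => (g_ n x)%:E) (EFin \o g) (cst C%:E).
- by move=> n; exact/measurable_EFinP.
- exact/measurable_EFinP.
- by apply: aeW => x Dx; apply: cvg_EFin; [exact: nearW|exact: g_g].
- exact: (@bounded_integrable (cst C) `|C|).
- by apply: aeW => x n Dx; rewrite lee_fin gC.
- move=> ig _ H; apply: fine_cvg.
  by rewrite fineK//; exact: integrable_fin_num.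
Qed.

End bounded_convergence.

(** * Independent random variables *)

Section independence.
Context (d : measure_display) (T : measurableType d) (R : realType).
Context (P : probability T R).
Import HBNNSimple.

Lemma probability_fin : (P setT < +oo)%E.
Proof. by rewrite (le_lt_trans (probability_le1 _ _))// ltry. Qed.

Lemma indic_comp (Z : T -> R) B w : \1_B (Z w) = \1_(Z @^-1` B) w :> R.
Proof.
by rewrite !indicE; congr (nat_of_bool _)%:R; apply/idP/idP; rewrite !inE.
Qed.

Lemma integral_nnsfun_comp (s : {nnsfun R >-> R}) (Z V : T -> R) :
  measurable_fun setT Z -> measurable_fun setT V -> (forall w, 0 <= V w) ->
  (\int[P]_w (s (Z w) * V w)%:E = \sum_(k \in range s)
     k%:E * \int[P]_w (\1_(s @^-1` [set k]) (Z w) * V w)%:E)%E.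
Proof.
move=> mZ mV V0.
have mi k : measurable_fun setT (\1_(s @^-1` [set k]) \o Z : T -> R).
  by apply: measurableT_comp mZ; exact: measurable_indic.
transitivity (\int[P]_w \sum_(k \in range s)
    (k * (\1_(s @^-1` [set k]) (Z w) * V w))%:E)%E.
  apply: eq_integral => w _; rewrite fsumEFin// [in LHS]fimfunE.
  by rewrite mulr_fsuml//; congr EFin; apply: eq_fsbigr => k _; rewrite mulrA.
rewrite ge0_integral_fsum//.
- apply: eq_fsbigr => k; rewrite inE => -[x _ <-].
  under eq_integral do rewrite EFinM.
  rewrite ge0_integralZl_EFin//.
    by move=> w _; rewrite lee_fin mulr_ge0.
  by apply/measurable_EFinP; apply: measurable_funM => //; exact: mi.
- move=> k; apply/measurable_EFinP; apply: measurable_funM => //.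
  by apply: measurable_funM => //; exact: mi.
- move=> k w _; rewrite mulrA EFinM mule_ge0// ?lee_fin//.
  by have := nnfun_muleindic_ge0 s k (Z w); rewrite -EFinM lee_fin.
Qed.

(** With [W] constant this is the transfer of an equality of laws to expectations;
with a general weight it is the one-variable step of the product rule for
independent variables.  Both sides are linear and monotonically continuous in
[h], so indicators suffice. *)
Lemma ge0_integral_transfer (X Y W : T -> R) (c : R) :
  measurable_fun setT X -> measurable_fun setT Y -> measurable_fun setT W ->
  (forall w, 0 <= W w) -> 0 <= c ->
  (forall B, measurable B ->
    \int[P]_w (\1_B (X w) * W w)%:E = c%:E * P (Y @^-1` B))%E ->
  forall h : R -> R, measurable_fun setT h -> (forall x, 0 <= h x) ->
    (\int[P]_w (h (X w) * W w)%:E = c%:E * \int[P]_w (h (Y w))%:E)%E.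
Proof.
move=> mX mY mW W0 c0 H h mh h0.
have mEh : measurable_fun [set: R] (EFin \o h) by exact/measurable_EFinP.
pose s := nnsfun_approx measurableT mEh.
have ms n : measurable_fun setT (s n) by exact: measurable_funP.
have scvg x : EFin \o s^~ x @ \oo --> (h x)%:E.
  by apply: (cvg_nnsfun_approx _ mEh) => // y _; rewrite lee_fin.
have snd x : {homo (fun n => s n x) : m n / (m <= n)%N >-> m <= n}.
  by move=> m n mn; exact/lefP/nd_nnsfun_approx.
have simple n : (\int[P]_w (s n (X w) * W w)%:E
    = c%:E * \int[P]_w (s n (Y w))%:E)%E.
  have ms1 k : measurable (s n @^-1` [set k]) by [].
  have mY1 k : measurable (Y @^-1` (s n @^-1` [set k])).
    by rewrite -[X in measurable X]setTI; exact: mY.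
  under [in RHS]eq_integral do rewrite -[s n _]mulr1.
  rewrite !integral_nnsfun_comp// ge0_mule_fsumr.
    apply: eq_fsbigr => k _; rewrite H// muleCA.
    under eq_integral do rewrite mulr1 indic_comp.
    by rewrite integral_indic// setIT.
  move=> k; have [k0|k0] := leP 0 k.
    by rewrite mule_ge0// integral_ge0// => w _; rewrite lee_fin mulr_ge0.
  (* a negative [k] is not a value of [s n], so its level set is empty *)
  rewrite (_ : s n @^-1` [set k] = set0).
    by rewrite integral0_eq ?mule0// => w _; rewrite indic0 mul0r.
  rewrite -subset0 => x /= xk; move: k0; rewrite -xk; apply/negP.
  by rewrite -leNgt.
transitivity (limn (fun n => \int[P]_w (s n (X w) * W w)%:E))%E.
  rewrite -monotone_convergence//.
  - apply: eq_integral => w _; apply/esym/cvg_lim => //.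
    under eq_fun do rewrite EFinM.
    by rewrite EFinM; apply: cvgeZr => //; exact: scvg.
  - move=> n; apply/measurable_EFinP; apply: measurable_funM => //.
    exact: measurableT_comp.
  - by move=> n w _; rewrite lee_fin mulr_ge0.
  - by move=> w _ m n mn; rewrite lee_fin ler_wpM2r// snd.
under eq_fun do rewrite simple.
apply/cvg_lim => //; apply: cvgeZl => //.
rewrite [X in _ --> X](_ : _ = (\int[P]_w (limn (fun n => (s n (Y w))%:E)))%E).
  apply: cvg_monotone_convergence => //.
  - by move=> n; apply/measurable_EFinP; exact: measurableT_comp.
  - by move=> n w _; rewrite lee_fin.
  - by move=> w _ m n mn; rewrite lee_fin snd.
apply: eq_integral => w _; apply/esym/cvg_lim => //; exact: scvg.
Qed.

Lemma integral_unit_fin_num (g : T -> R) : measurable_fun setT g ->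
  (forall w, 0 <= g w <= 1) -> (\int[P]_w (g w)%:E)%E \is a fin_num.
Proof.
move=> mg g01; have g0 w : 0 <= g w by case/andP: (g01 w).
rewrite ge0_fin_numE; last by rewrite integral_ge0// => w _; rewrite lee_fin.
apply: (@le_lt_trans _ _ (\int[P]_w (cst 1 w)))%E.
  apply: ge0_le_integral => //; first by move=> w _; rewrite lee_fin.
    exact/measurable_EFinP.
  by move=> w _; rewrite lee_fin; case/andP: (g01 w).
by rewrite integral_cst// mul1e (le_lt_trans (probability_le1 _ _))// ltry.
Qed.

(** The hypothesis is the case where every [F i] is an indicator.  Indicators are
replaced by arbitrary functions one index at a time: in the induction, only the
indices at least [k] are still required to carry indicators. *)
Lemma integral_prod_independent (n : nat) (X : 'I_n -> T -> R) :
  (forall i, measurable_fun setT (X i)) -> mutually_independent P X ->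
  forall F : 'I_n -> R -> R, (forall i, measurable_fun setT (F i)) ->
    (forall i x, 0 <= F i x <= 1) ->
  (\int[P]_w (\prod_i F i (X i w))%:E = \prod_i \int[P]_w (F i (X i w))%:E)%E.
Proof.
move=> mX indX.
have mXB i B : measurable B -> measurable (X i @^-1` B).
  by move=> mB; rewrite -[X in measurable X]setTI; exact: mX.
suff H k (F : 'I_n -> R -> R) : (forall i, measurable_fun setT (F i)) ->
    (forall i x, 0 <= F i x <= 1) ->
    (forall i : 'I_n, (k <= i)%N -> exists2 B, measurable B & F i = \1_B) ->
    (\int[P]_w (\prod_i F i (X i w))%:E = \prod_i \int[P]_w (F i (X i w))%:E)%E.
  move=> F mF F01; apply: (H n) => // i; by rewrite leqNgt ltn_ord.
elim: k F => [|k IH] F mF F01 Find.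
  pose B i := s2val (cid2 (Find i isT)).
  have mB i : measurable (B i) := s2valP (cid2 (Find i isT)).
  have FB i : F i = \1_(B i) := s2valP' (cid2 (Find i isT)).
  transitivity (P (\bigcap_(i in [set: 'I_n]) (X i @^-1` B i))).
    rewrite -[X in P X]setIT -integral_indic//; last first.
      by apply: fin_bigcap_measurable => [|i _]; [exact: finite_finset|exact: mXB].
    apply: eq_integral => w _; congr EFin; rewrite indicE.
    have [wB|/existsNP[i wB]] := pselect (forall i, B i (X i w)).
      rewrite mem_set; last by move=> i _; exact: wB.
      by rewrite big1// => i _; rewrite FB indicE mem_set.
    rewrite memNset; last by move=> /(_ i I).
    by rewrite (bigD1 i)//= FB indicE memNset// mul0r.
  rewrite indX//; apply: eq_bigr => i _.
  under [RHS]eq_integral do rewrite FB indic_comp.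
  by rewrite integral_indic// ?setIT//; exact: mXB.
have [nk|kn] := leqP n k.
  apply: IH => // i ki; exfalso; move: (ltn_ord i); rewrite ltnNge.
  by rewrite (leq_trans nk ki).
pose j := Ordinal kn.
pose W w := \prod_(i | i != j) F i (X i w).
have mFX i : measurable_fun setT (F i \o X i) by exact: measurableT_comp.
have F0 i x : 0 <= F i x by case/andP: (F01 i x).
pose c := \prod_(i | i != j) fine (\int[P]_w (F i (X i w))%:E)%E.
have cE : (c%:E = \prod_(i | i != j) \int[P]_w (F i (X i w))%:E)%E.
  rewrite (big_morph _ (@EFinM R) erefl); apply: eq_bigr => i _.
  by rewrite fineK//; apply: (integral_unit_fin_num (mFX i)) => w; exact: F01.
rewrite (bigD1 j)//= -cE muleC.
under eq_integral do rewrite (bigD1 j)//=.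
apply: (@ge0_integral_transfer (X j) (X j) W) => //.
- rewrite /W; under eq_fun do rewrite -big_filter.
  by apply: measurable_prod => i _; exact: mFX.
- by move=> w; rewrite /W prodr_ge0.
- apply: prodr_ge0 => i _; rewrite fine_ge0// integral_ge0// => w _.
  by rewrite lee_fin.
move=> B mB.
have := IH (fun i => if i == j then \1_B else F i).
rewrite (bigD1 j)//= eqxx.
under [in X in _ -> _ -> _ -> _ = (_ * X)%E]eq_bigr => i ij do
  under eq_integral do rewrite (negbTE ij).
rewrite -cE.
under [in X in _ -> _ -> _ -> _ = (X * _)%E]eq_integral do rewrite indic_comp.
rewrite integral_indic// ?setIT ?[(P _ * _)%E]muleC; last exact: mXB.
move=> <-.
- apply: eq_integral => w _; rewrite (bigD1 j)//= eqxx /W; congr (_ * _)%:E.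
  by apply: eq_bigr => i ij; rewrite (negbTE ij).
- by move=> i; case: ifP => // _; exact: measurable_indic.
- move=> i x; case: ifP => // _; rewrite indicE.
  by case: (x \in B); rewrite /= ?lexx ?ler01.
- move=> i ki; case: ifPn => [_|ij]; first by exists B.
  apply: Find; rewrite ltn_neqAle ki andbT; apply: contra ij => /eqP kij.
  by apply/eqP/val_inj.
Qed.

End independence.

(** * Baire functions *)

Section baire.
Context (R : realType).

(** The least class containing the continuous functions and stable under
pointwise limits of sequences.  Being inductive, it turns a proof about all
Borel functions into one about continuous functions and one about limits. *)
Inductive baire_function : (R -> R) -> Prop :=
| baire_continuous f : continuous f -> baire_function f
| baire_cvg (g : nat -> R -> R) f : (forall n, baire_function (g n)) ->
    (forall x, g n x @[n --> \oo] --> f x) -> baire_function f.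

(** A two-step induction: the first variable is moved through the limits while the
second is fixed, after the second has been moved with a continuous first one. *)
Lemma baire_op2 (op : R -> R -> R) (f g : R -> R) :
  continuous (fun z : R * R => op z.1 z.2) ->
  baire_function f -> baire_function g ->
  baire_function (fun x => op (f x) (g x)).
Proof.
move=> cop.
have opcvg (I : Type) (F : set_system I) (FF : Filter F) (u v : I -> R) a b :
    u x @[x --> F] --> a -> v x @[x --> F] --> b ->
    op (u x) (v x) @[x --> F] --> op a b.
  move=> ua vb; apply: (cvg_comp (fun x => (u x, v x))
    (fun z : R * R => op z.1 z.2) (cvg_pair ua vb)).
  exact: (cop (a, b)).
elim=> {f}[f cf|f_ f _ IH f_f].
  elim=> {g}[g cg|g_ g _ IH g_g].
    apply: baire_continuous => x; exact: (opcvg _ _ _ f g _ _ (cf x) (cg x)).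
  apply: (baire_cvg IH) => x; apply: opcvg => //; exact: cvg_cst.
move=> bg; apply: (baire_cvg (fun n => IH n bg)) => x.
apply: opcvg => //; exact: cvg_cst.
Qed.

Lemma baireD f g : baire_function f -> baire_function g ->
  baire_function (fun x => f x + g x).
Proof. by apply: baire_op2 => -[a b]; exact: add_continuous. Qed.

Lemma baireM f g : baire_function f -> baire_function g ->
  baire_function (fun x => f x * g x).
Proof. by apply: baire_op2 => -[a b]; exact: mul_continuous. Qed.

Lemma baire_cst c : baire_function (cst c).
Proof. by apply: baire_continuous => x; exact: cvg_cst. Qed.

Lemma baire_indicC (A : set R) :
  baire_function \1_A -> baire_function \1_(~` A).
Proof.
move=> bA; rewrite (_ : \1_(~` A) = fun x => 1 + -1 * \1_A x).
  by apply: baireD; [exact: baire_cst|apply: baireM => //; exact: baire_cst].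
apply/funext => x; rewrite !indicE in_setC.
by case: (x \in A); rewrite /= ?mulr1 ?mulr0 ?subrr ?addr0.
Qed.

Lemma baire_indicU (A B : set R) :
  baire_function \1_A -> baire_function \1_B -> baire_function \1_(A `|` B).
Proof.
move=> bA bB; rewrite -[_ `|` _]setCK setCU; apply: baire_indicC.
rewrite indicI; apply: baireM; exact: baire_indicC.
Qed.

Lemma baire_indic_oy a : baire_function \1_(`]a, +oo[%classic : set R).
Proof.
pose g n (x : R) := Num.min 1 (n%:R * Num.max 0 (x - a)).
apply: (@baire_cvg g).
  move=> n; apply: baire_continuous => x; apply: cvg_minr.
    exact: cvg_cst.
  apply: cvgM; first exact: cvg_cst.
  apply: cvg_maxr; first exact: cvg_cst.
  by apply: cvgB; [exact: cvg_id|exact: cvg_cst].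
move=> x; rewrite indicE; have [xa|ax] := leP x a.
  rewrite memNset; last by rewrite /= in_itv/= andbT; apply/negP; rewrite -leNgt.
  rewrite /g (max_idPl _) ?subr_le0//.
  by under eq_fun do rewrite mulr0 (min_idPr _)//; exact: cvg_cst.
rewrite mem_set; last by rewrite /= in_itv/= ax.
apply: cvg_near_cst; near=> n.
rewrite /g (max_idPr _) ?subr_ge0 ?ltW// (min_idPl _)//.
rewrite -ler_pdivrMr ?subr_gt0//.
near: n; exact: nbhs_infty_ger.
Unshelve. all: by end_near. Qed.

(** Complements are [1 - u], intersections are products, and a countable union is
the limit of the finite ones; so the sets with a Baire indicator form a
sigma-algebra, which contains the open rays that generate the Borel sets. *)
Lemma baire_indic (A : set R) : measurable A -> baire_function \1_A.
Proof.
rewrite /measurable/= /measurableR RGenOInfty.measurableE.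
apply: (smallest_sub (C := sigma_algebra setT)
  (X := [set A | baire_function \1_A])).
  split.
  - by rewrite /= indic0; exact: baire_cst.
  - by move=> B; rewrite /= setTD; exact: baire_indicC.
  move=> F bF /=.
  apply: (@baire_cvg (fun n => \1_(\big[setU/set0]_(i < n) F i))).
    elim=> [|n IH]; first by rewrite big_ord0 indic0; exact: baire_cst.
    by rewrite big_ord_recr/=; apply: baire_indicU => //; exact: bF.
  move=> x; apply: cvg_near_cst.
  have [[k _ Fk]|xF] := pselect ((\bigcup_k F k) x).
    near=> n; rewrite !indicE [x \in \bigcup__ _]mem_set; last by exists k.
    rewrite mem_set//.
    rewrite -bigcup_mkord; exists k => //=.
    near: n; exact: nbhs_infty_gt.
  near=> n; rewrite !indicE !memNset// -bigcup_mkord => -[k _ Fk].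
  by apply: xF; exists k.
by move=> _ [a ->]; exact: baire_indic_oy.
Unshelve. all: by end_near. Qed.

Import HBSimple.

Lemma baire_measurable (f : R -> R) :
  measurable_fun setT f -> baire_function f.
Proof.
move=> mf; have mEf : measurable_fun [set: R] (EFin \o f).
  exact/measurable_EFinP.
have [g gf] := approximation_sfun measurableT mEf.
apply: (@baire_cvg (fun n x => g n x)); last first.
  by move=> x; have /fine_cvgP[_] := gf x I.
move=> n; under eq_fun do rewrite fimfunE fsbig_finite//=.
elim: (finmap.enum_fset _) => [|y s IH].
  under eq_fun do rewrite big_nil; exact: baire_cst.
under eq_fun do rewrite big_cons; apply: baireD => //.
apply: baireM; first exact: baire_cst.
exact: baire_indic.
Qed.

Lemma measurable_baire (g : R -> R) : baire_function g -> measurable_fun setT g.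
Proof.
elim=> {g}[g cg|g_ g _ mg gg]; first exact: continuous_measurable_fun.
by apply: (measurable_fun_cvg mg) => x _; exact: gg.
Qed.

End baire.

(** * The Bernstein function of a subordinator *)

Section bernstein.
Context (d : measure_display) (T : measurableType d) (R : realType).
Context (P : probability T R) (S : R -> {RV P >-> R}).
Hypothesis HS : subordinator S.
Context (phi : R -> R).
Hypothesis Hphi : bernstein_function_of S phi.

Lemma subordinator_ge0 (t : R) w : 0 <= t -> 0 <= S t w.
Proof.
move=> t0; rewrite -(levy_start (subordinator_levy HS) w).
exact: (subordinator_nondecreasing HS).
Qed.

Lemma laplace_ge0 (r t : R) : 0 <= r -> 0 <= t ->
  (\int[P]_w (expR (- (r * S t w)))%:E = (expR (- (t * phi r)))%:E)%E.
Proof.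
rewrite le_eqVlt => /predU1P[<-|r0] t0.
  rewrite (bernstein_at0 Hphi) mulr0.
  under eq_integral do rewrite mul0r.
  by rewrite oppr0 expR0 integral_cst// mul1e; exact: probability_setT.
rewrite -[- (t * _)]mulNr -(bernstein_laplace Hphi r0 t0) unlock.
by apply: eq_integral => w _; rewrite -mulNr.
Qed.

Lemma expR_oppM_le1 (r s : R) : 0 <= r -> 0 <= s -> expR (- (r * s)) <= 1.
Proof. by move=> r0 s0; rewrite -expR0 ler_expR oppr_le0 mulr_ge0. Qed.

Lemma measurable_laplace (r t : R) :
  measurable_fun setT (fun w => expR (- (r * S t w))).
Proof.
apply: measurableT_comp => //; apply: measurableT_comp => //.
exact: measurable_funM.
Qed.

Lemma phi_nondecreasing (r s : R) : 0 <= r -> r <= s -> phi r <= phi s.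
Proof.
move=> r0 rs; have s0 := le_trans r0 rs.
have : ((expR (- (1 * phi s)))%:E <= (expR (- (1 * phi r)))%:E)%E.
  rewrite -(laplace_ge0 s0 (@ler01 R)) -(laplace_ge0 r0 (@ler01 R)).
  apply: ge0_le_integral.
  - by [].
  - by move=> w _; rewrite lee_fin expR_ge0.
  - exact/measurable_EFinP/measurable_laplace.
  - exact/measurable_EFinP/measurable_laplace.
  - move=> w _; rewrite lee_fin ler_expR lerN2 ler_wpM2r//.
    exact: subordinator_ge0.
by rewrite !mul1r lee_fin ler_expR lerN2.
Qed.

Lemma phi_ge0 (r : R) : 0 <= r -> 0 <= phi r.
Proof. by move=> r0; rewrite -(bernstein_at0 Hphi) phi_nondecreasing. Qed.

(** [phi r] is minus the logarithm of the Laplace transform of [S 1] at [r], whose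
continuity is bounded convergence.  The value [0] at the origin fits because
[S 1] is finite. *)
Lemma phi_cvg (u : nat -> R) (a : R) : (forall n, 0 <= u n) -> 0 <= a ->
  u n @[n --> \oo] --> a -> phi (u n) @[n --> \oo] --> phi a.
Proof.
move=> u0 a0 ua.
have phiE r : 0 <= r -> phi r = - ln (\int[P]_w expR (- (r * S 1 w))).
  by move=> r0; rewrite /Rintegral laplace_ge0//= expRK opprK mul1r.
rewrite phiE//; under eq_fun do rewrite phiE//.
apply: cvgN; apply: continuous_cvg.
  by apply: continuous_ln; rewrite /Rintegral laplace_ge0//= expR_gt0.
apply: (@bounded_cvg_Rintegral _ _ _ _ _ _ _ _ _ 1) => //.
- by rewrite (le_lt_trans (probability_le1 _ _))// ltry.
- by move=> n; exact: measurable_laplace.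
- move=> n w _; rewrite ger0_norm ?expR_ge0// expR_oppM_le1//.
  exact: subordinator_ge0.
- move=> w _; apply: continuous_cvg; first exact: continuous_expR.
  by apply: cvgN; apply: cvgM => //; exact: cvg_cst.
Qed.

Lemma measurable_phi (d' : measure_display) (X : measurableType d') (D : set X)
    (g : X -> R) :
  measurable_fun D g -> (forall x, 0 <= g x) ->
  measurable_fun D (fun x => phi (g x)).
Proof.
move=> mg g0; have -> : (fun x => phi (g x)) = (fun y => phi (Num.max 0 y)) \o g.
  by apply/funext => x /=; rewrite (max_idPr _).
apply: measurableT_comp mg; apply: nondecreasing_measurable => //.
move=> x y xy; apply: phi_nondecreasing; first by rewrite le_max lexx.
by rewrite ge_max !le_max lexx xy /= orbT.
Qed.

End bernstein.

(** * Step functions on a uniform grid *)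

Lemma lebesgue_stieltjes_measure_oc (R : realType) (F : cumulative R R)
    (a b : R) : a <= b ->
  lebesgue_stieltjes_measure F `]a, b]%classic = (F b - F a)%:E.
Proof.
move=> ab; rewrite /lebesgue_stieltjes_measure /measure_extension.
rewrite measurable_mu_extE; last exact: is_ocitv.
exact: wlength_itv_bnd.
Qed.

Section step_functions.
Context (R : realType).

Lemma lebesgue_measure_oc (a b : R) : a <= b ->
  lebesgue_measure (`]a, b]%classic : set R) = (b - a)%:E.
Proof.
by move=> ab; rewrite lebesgue_measure_itv/= lte_fin; case: ltgtP ab => // ->;
  rewrite subrr.
Qed.

Lemma integral_step (mu : {measure set (measurableTypeR R) -> \bar R})
    (t c : nat -> R) (h : R -> R) (N : nat) :
  (forall i, t i <= t i.+1) -> (forall x, 0 <= h x) -> measurable_fun setT h ->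
  (forall i x, t i < x <= t i.+1 -> h x = c i) ->
  (\int[mu]_(x in `]t 0%N, t N]) (h x)%:E =
   \sum_(i < N) (c i)%:E * mu `]t i, t i.+1]%classic)%E.
Proof.
move=> tnd h0 mh hc; elim: N => [|N IH].
  by rewrite big_ord0 set_itv_ge ?bnd_simp ?ltxx// integral_set0.
have tN : t 0%N <= t N by elim: N {IH} => // N /le_trans; exact.
rewrite big_ord_recr/= -IH.
rewrite (@itv_bndbnd_setU _ _ (BRight (t 0%N)) (BRight (t N)))//.
rewrite ge0_integral_setU//=.
- congr (_ + _)%E; rewrite -integral_cst//.
  apply: eq_integral => x; rewrite inE/= in_itv/= => xt.
  by rewrite (hc _ _ xt).
- by apply/measurable_EFinP; apply: measurable_funTS.
- by move=> x _; rewrite lee_fin.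
- apply/disj_setPS => x [] /=; rewrite !in_itv/= => /andP[_ xN] /andP[Nx _].
  by move: (lt_le_trans Nx xN); rewrite ltxx.
- by rewrite bnd_simp.
Qed.

(** Rounding up, so that [g \o grid m] is constant on the left-open pieces
[(i / (m + 1), (i + 1) / (m + 1)]], whose masses are the increments of the path. *)
Definition grid (m : nat) (t : R) : R :=
  (Num.ceil (t * m.+1%:R))%:~R / m.+1%:R.

Lemma grid_cvg (t : R) : grid m t @[m --> \oo] --> t.
Proof.
apply: (@squeeze_cvgr _ _ _ _ (fun=> t) (fun m => t + m.+1%:R^-1)).
- apply: nearW => m; rewrite /grid ler_pdivlMr ?ltr0n// ceil_ge/=.
  rewrite ler_pdivrMr ?ltr0n// mulrDl mulVf ?pnatr_eq0// ltW//.
  by have := ceilB1_lt (t * m.+1%:R); rewrite intrB ltrBlDr.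
- exact: cvg_cst.
- rewrite -[X in _ --> X]addr0; apply: cvgD; first exact: cvg_cst.
  exact: cvg_harmonic.
Qed.

Lemma grid_piece m i x : i%:R / m.+1%:R < x <= i.+1%:R / m.+1%:R ->
  grid m x = i.+1%:R / m.+1%:R.
Proof.
rewrite ltr_pdivrMr ?ltr0n// ler_pdivlMr ?ltr0n// => /andP[ix xi].
rewrite /grid; congr (_ / _); rewrite -[RHS]mulrz_nat; congr (_%:~R).
apply: ceil_def; apply/andP; split; last by rewrite mulrz_nat.
by rewrite -natr1 addrK mulrz_nat.
Qed.

Lemma measurable_grid m : measurable_fun setT (grid m).
Proof.
apply: nondecreasing_measurable => // x y xy; rewrite /grid.
by rewrite ler_pM2r ?invr_gt0 ?ltr0n// ler_int ceil_le// ler_pM2r ?ltr0n.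
Qed.

End step_functions.

(** * The Laplace functional for bounded integrands *)

Section laplace_functional.
Context (d : measure_display) (T : measurableType d) (R : realType).
Context (P : probability T R) (S : R -> {RV P >-> R}).
Hypothesis HS : subordinator S.
Context (phi : R -> R).
Hypothesis Hphi : bernstein_function_of S phi.

Local Notation M w := (lebesgue_stieltjes_measure (path_cumulative HS w)).
Local Notation lambda := (@lebesgue_measure R).
Local Notation window K := (`]0%R, K]%classic : set R).

Lemma stieltjes_measure_oc w (a b : R) : 0 <= a -> a <= b ->
  M w `]a, b]%classic = (S b w - S a w)%:E.
Proof.
move=> a0 ab; rewrite lebesgue_stieltjes_measure_oc//= /path0.
by rewrite (max_idPr a0) (max_idPr (le_trans a0 ab)).
Qed.

Lemma stieltjes_measure_fin w (K : R) : 0 <= K -> (M w (window K) < +oo)%E.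
Proof. by move=> K0; rewrite stieltjes_measure_oc// ltry. Qed.

(** The measurability of the random integral is part of the property because the
expectation of a pointwise limit is only under control when it holds; both
parts are carried through limits together. *)
Definition laplace_formula (K : R) (g : R -> R) : Prop :=
  measurable_fun setT (fun w => \int[M w]_(t in window K) g t) /\
  \int[P]_w expR (- \int[M w]_(t in window K) g t) =
    expR (- \int[lambda]_(t in window K) phi (g t)).

(** The increments are nonnegative; [Num.max 0] is there to make the function of the
increment take values in [0, 1] on all of [R]. *)
Lemma increment_laplace (s h c : R) : 0 <= s -> 0 <= h -> 0 <= c ->
  (\int[P]_w (expR (- (c * Num.max 0 (S (s + h) w - S s w))))%:E =
   (expR (- (h * phi c)))%:E)%E.
Proof.
move=> s0 h0 c0; rewrite -(laplace_ge0 Hphi c0 h0).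
pose F x := expR (- (c * Num.max 0 x)).
have mF : measurable_fun setT F.
  apply: measurableT_comp => //; apply: measurableT_comp => //.
  by apply: measurable_funM => //; exact: measurable_maxr.
have mX : measurable_fun setT (fun w => S (s + h) w - S s w).
  exact: measurable_funB.
have := @ge0_integral_transfer _ _ _ P _ (S h) (cst 1) 1 mX _ _ _ _ _ F mF.
rewrite mul1e; under eq_integral do rewrite mulr1.
move=> ->//.
- by apply: eq_integral => w _; rewrite /F (max_idPr _)//; exact: subordinator_ge0.
- move=> B mB; under eq_integral do rewrite mulr1 indic_comp.
  rewrite mul1e integral_indic// ?setIT.
    exact: (levy_stationary_increments (subordinator_levy HS)).
  by rewrite -[X in measurable X]setTI; exact: mX.
- by move=> x; exact: expR_ge0.
Qed.

(** The integral is a finite sum of weighted increments, so the exponential is a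
product of functions of independent variables, each with a known mean. *)
Lemma laplace_formula_grid (K m : nat) (g : R -> R) :
  measurable_fun setT g -> (forall x, 0 <= g x) ->
  laplace_formula K%:R (g \o grid m).
Proof.
move=> mg g0.
pose t (i : nat) : R := i%:R / m.+1%:R.
pose c (i : nat) : R := g (t i.+1).
have m0 : 0 < m.+1%:R :> R by rewrite ltr0n.
have t0 i : 0 <= t i by rewrite divr_ge0.
have tnd i : t i <= t i.+1 by rewrite ler_pM2r ?invr_gt0// ler_nat.
pose N := (K * m.+1)%N.
have t0E : t 0%N = 0 by rewrite /t mul0r.
have tNE : t N = K%:R by rewrite /t natrM mulfK// gt_eqF.
have dt i : t i.+1 = t i + m.+1%:R^-1 by rewrite /t -natr1 mulrDl mul1r.
have mgrid : measurable_fun setT (g \o grid m).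
  by apply: measurableT_comp mg _; exact: measurable_grid.
have grid0 x : 0 <= (g \o grid m) x by exact: g0.
have gridc i x : t i < x <= t i.+1 -> (g \o grid m) x = c i.
  by move=> xi; rewrite /= (grid_piece xi).
have JE w : \int[M w]_(x in window K%:R) (g \o grid m) x =
    \sum_(i < N) c i * (S (t i.+1) w - S (t i) w).
  have := @integral_step R (M w) t c _ N tnd grid0 mgrid gridc.
  rewrite t0E tNE /Rintegral => ->; rewrite -[RHS]/(fine _%:E) -sumEFin.
  congr fine; apply: eq_bigr => i _; rewrite EFinM; congr (_ * _)%E.
  exact: stieltjes_measure_oc.
have phiE : \int[lambda]_(x in window K%:R) phi ((g \o grid m) x) =
    \sum_(i < N) m.+1%:R^-1 * phi (c i).
  have := @integral_step R lambda t (phi \o c) (phi \o (g \o grid m)) N tnd.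
  rewrite t0E tNE /Rintegral => ->.
  - rewrite -[RHS]/(fine _%:E) -sumEFin; congr fine; apply: eq_bigr => i _.
    rewrite mulrC EFinM; congr (_ * _)%E.
    by rewrite dt [LHS]lebesgue_measure_oc ?lerDl ?invr_ge0// addrAC subrr add0r.
  - by move=> x; apply: (phi_ge0 HS Hphi).
  - exact: (measurable_phi HS Hphi).
  - by move=> i x xi; rewrite [LHS]/= (grid_piece xi).
split.
  under eq_fun do rewrite JE.
  apply: measurable_sum => i; apply: measurable_funM => //.
  exact: measurable_funB.
rewrite phiE -sumrN expR_sum.
pose F (i : 'I_N) (x : R) := expR (- (c i * Num.max 0 x)).
have indX := levy_independent_increments (subordinator_levy HS)
  (n := N) (t0 0%N) (fun i _ => tnd i).
have E := integral_prod_independent _ indX (F := F).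
transitivity (fine (\int[P]_w (\prod_i F i (S (t i.+1) w - S (t i) w))%:E)).
  congr fine; apply: eq_integral => w _; congr EFin.
  rewrite JE -sumrN expR_sum; apply: eq_bigr => i _.
  rewrite /F (max_idPr _)// subr_ge0.
  exact: (subordinator_nondecreasing HS).
rewrite E.
- rewrite -[RHS]/(fine _%:E) (big_morph _ (@EFinM R) erefl).
  congr fine; apply: eq_bigr => i _.
  have h0 : 0 <= m.+1%:R^-1 :> R by rewrite invr_ge0.
  by have := increment_laplace (t0 i) h0 (g0 (t i.+1)); rewrite -dt.
- by move=> i; exact: measurable_funB.
- move=> i; apply: measurableT_comp => //; apply: measurableT_comp => //.
  by apply: measurable_funM => //; exact: measurable_maxr.
- move=> i x; rewrite expR_ge0/= expR_oppM_le1//; first exact: g0.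
  by rewrite le_max lexx.
Qed.

Lemma laplace_formula_cvg (K C : R) (g_ : nat -> R -> R) (g : R -> R) :
  0 <= K ->
  (forall n, measurable_fun setT (g_ n)) ->
  (forall n x, 0 <= g_ n x <= C) ->
  (forall x, g_ n x @[n --> \oo] --> g x) ->
  (forall n, laplace_formula K (g_ n)) -> laplace_formula K g.
Proof.
move=> K0 mg g0C gg H.
have g_0 n x : 0 <= g_ n x by case/andP: (g0C n x).
have g_C n x : g_ n x <= C by case/andP: (g0C n x).
have g0 x : 0 <= g x.
  rewrite -(cvg_lim _ (gg x))//; apply: limr_ge; first exact: cvgP (gg x).
  exact: nearW.
have JJ w : \int[M w]_(t in window K) g_ n t @[n --> \oo] -->
    \int[M w]_(t in window K) g t.
  apply: (@bounded_cvg_Rintegral _ _ _ (M w) (window K) _ _ _ _ C) => //.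
  - exact: stieltjes_measure_fin.
  - by move=> n; apply: measurable_funTS; exact: mg.
  - by move=> n x _; rewrite ger0_norm.
have mJ : measurable_fun setT (fun w => \int[M w]_(t in window K) g t).
  apply: (measurable_fun_cvg (h := fun n w => \int[M w]_(t in window K) g_ n t)).
    by move=> n; case: (H n).
  by move=> w _; exact: JJ.
split => //.
have cexp (u : nat -> R) a : u n @[n --> \oo] --> a ->
    expR (- u n) @[n --> \oo] --> expR (- a).
  move=> ua; apply: continuous_cvg; first exact: continuous_expR.
  exact: cvgN.
have lhs : \int[P]_w expR (- \int[M w]_(t in window K) g_ n t) @[n --> \oo]
    --> \int[P]_w expR (- \int[M w]_(t in window K) g t).
  apply: (@bounded_cvg_Rintegral _ _ _ P setT _ _ _ _ 1) => //.
  - exact: probability_fin.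
  - move=> n; apply: measurableT_comp => //; apply: measurableT_comp => //.
    by case: (H n).
  - move=> n w _; rewrite ger0_norm ?expR_ge0// -expR0 ler_expR oppr_le0.
    exact: Rintegral_ge0.
  - by move=> w _; exact: cexp.
have rhs : expR (- \int[lambda]_(t in window K) phi (g_ n t)) @[n --> \oo]
    --> expR (- \int[lambda]_(t in window K) phi (g t)).
  apply: cexp.
  apply: (@bounded_cvg_Rintegral _ _ _ lambda (window K) _ _ _ _ (phi C)) => //.
  - by rewrite [X in (X < _)%E]lebesgue_measure_oc// ltry.
  - move=> n; apply: measurable_funTS.
    by apply: (measurable_phi HS Hphi) => //; exact: mg.
  - move=> n x _; rewrite ger0_norm; first exact: (phi_nondecreasing HS Hphi).
    exact: (phi_ge0 HS Hphi).
  - by move=> x _; exact: (phi_cvg HS Hphi).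
have lrE : (fun n => \int[P]_w expR (- \int[M w]_(t in window K) g_ n t)) =
    (fun n => expR (- \int[lambda]_(t in window K) phi (g_ n t))).
  by apply/funext => n; case: (H n).
by move: rhs; rewrite -lrE; exact: cvg_unique lhs.
Qed.

Lemma laplace_formula_clamp (K : nat) (C : R) (g : R -> R) : 0 <= C ->
  measurable_fun setT g -> laplace_formula K%:R (clamp C \o g).
Proof.
move=> C0 /baire_measurable; elim=> {g}[g cg|g_ g bg IH gg].
  have mcg : measurable_fun setT (clamp C \o g).
    apply: (measurableT_comp (measurable_clamp C)).
    exact: continuous_measurable_fun.
  apply: (laplace_formula_cvg (C := C)
    (g_ := fun m => (clamp C \o g) \o grid m)) => //.
  - by move=> m; apply: measurableT_comp mcg _; exact: measurable_grid.
  - by move=> m x; exact: clamp_itv.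
  - move=> x; apply: clamp_cvg; apply: continuous_cvg; first exact: cg.
    exact: grid_cvg.
  - move=> m; apply: laplace_formula_grid => // x.
    by case/andP: (clamp_itv (g x) C0).
apply: (laplace_formula_cvg (C := C) (g_ := fun n => clamp C \o g_ n)) => //.
- move=> n; apply: (measurableT_comp (measurable_clamp C)).
  exact: measurable_baire.
- by move=> n x; exact: clamp_itv.
- by move=> x; exact: clamp_cvg.
Qed.

End laplace_functional.

(** * The Laplace functional for nonnegative integrands *)

Section exhaustion.
Context (R : realType) (mu : {measure set (measurableTypeR R) -> \bar R}).
Local Notation window K := (`]0%R, K]%classic : set R).
Hypothesis mu_window : forall n : nat, (mu (window n%:R) < +oo)%E.

(** Stated for a function [psi] of the integrand because it serves twice: with the
identity and a path measure, and with [phi] and Lebesgue measure. *)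
Lemma cvg_Rintegral_window (psi f : R -> R) :
  (forall x y : R, 0 <= x -> x <= y -> psi x <= psi y) ->
  (forall x : R, 0 <= x -> 0 <= psi x) ->
  (forall n : nat, measurable_fun setT (fun x => psi (clamp n%:R (f x)))) ->
  (forall x, 0 <= f x) ->
  (\int[mu]_(x in window n%:R) psi (clamp n%:R (f x)))%:E @[n --> \oo] -->
  (\int[mu]_(x in `]0%R, +oo[) (psi (f x))%:E)%E.
Proof.
move=> psi_nd psi0 mpsi f0.
have c0 n (x : R) : 0 <= clamp n%:R x by case/andP: (clamp_itv x (ler0n R n)).
have cn n (x : R) : clamp n%:R x <= n%:R by case/andP: (clamp_itv x (ler0n R n)).
pose g n x : \bar R := (((fun x => psi (clamp n%:R (f x))) \_ (window n%:R)) x)%:E.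
have gE n : (\int[mu]_(x in window n%:R) psi (clamp n%:R (f x)))%:E =
    (\int[mu]_(x in `]0%R, +oo[) g n x)%E.
  rewrite /Rintegral fineK.
    rewrite (_ : window n%:R = `]0%R, +oo[%classic `&` window n%:R).
      rewrite integral_mkcondr; apply: eq_integral => x _.
      by rewrite /g restrict_EFin.
    apply/seteqP; split => x /=; rewrite !in_itv/=; last by case.
    by move=> xn; split => //; case/andP: xn => ->.
  apply: integrable_fin_num => //.
  apply: (@bounded_integrable _ _ _ _ _ _ _ _ (psi n%:R)) => //.
    by apply: measurable_funTS; exact: mpsi.
  by move=> x _; rewrite ger0_norm ?psi0// psi_nd.
under eq_fun do rewrite gE.
rewrite (_ : (\int[mu]_(x in _) (psi (f x))%:E)%E =
   (\int[mu]_(x in `]0%R, +oo[) limn (g ^~ x))%E); last first.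
  apply: eq_integral => x; rewrite inE/= in_itv/= andbT => x0.
  apply/esym/cvg_lim => //; apply: cvg_near_cst; near=> n.
  rewrite /g patchE mem_set; last first.
    by rewrite /= in_itv/= x0/=; near: n; exact: nbhs_infty_ger.
  rewrite /clamp ger0_norm// (min_idPl _)//.
  by near: n; exact: nbhs_infty_ger.
apply: cvg_monotone_convergence => //.
- move=> n; apply/measurable_EFinP; apply: measurable_funTS.
  by apply/(measurable_restrictT _ _).1 => //; apply: measurable_funTS; exact: mpsi.
- by move=> n x _; rewrite lee_fin patchE; case: ifP => // _; exact: psi0.
move=> x _ m n mn; rewrite lee_fin !patchE.
have mnR : m%:R <= n%:R :> R by rewrite ler_nat.
case: ifPn => [|_]; last by case: ifP => // _; exact: psi0.
rewrite inE/= in_itv/= => /andP[x0 xm].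
rewrite mem_set; last by rewrite /= in_itv/= x0 (le_trans xm).
by apply: psi_nd => //; rewrite /clamp le_min !ge_min lexx mnR orbT.
Unshelve. all: by end_near. Qed.

End exhaustion.

Section exp_neg_ereal.
Context (R : realType).

(** Equal to [exp (- x)] for [x] in [0, +oo], and real-valued so that bounded
convergence applies to it directly. *)
Definition expeN (x : \bar R) : R := if x is r%:E then expR (- r) else 0.

Lemma expeN_ge0 x : 0 <= expeN x.
Proof. by case: x => //= r; exact: expR_ge0. Qed.

Lemma cvg_expeN (u : nat -> R) (x : \bar R) : (0 <= x)%E ->
  (u n)%:E @[n --> \oo] --> x -> expR (- u n) @[n --> \oo] --> expeN x.
Proof.
case: x => [r _ /fine_cvg ur|_ uy|//] /=.
  by apply: continuous_cvg; [exact: continuous_expR|exact: cvgN].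
have {}uy : u n @[n --> \oo] --> +oo by exact/cvgeryP.
exact: (cvg_comp _ _ uy (@cvgr_expR R)).
Qed.

End exp_neg_ereal.

Section laplace_functional_integral.
Context (d : measure_display) (T : measurableType d) (R : realType).
Context (P : probability T R) (S : R -> {RV P >-> R}).
Hypothesis HS : subordinator S.
Context (phi : R -> R).
Hypothesis Hphi : bernstein_function_of S phi.

Local Notation M w := (lebesgue_stieltjes_measure (path_cumulative HS w)).
Local Notation lambda := (@lebesgue_measure R).
Local Notation window K := (`]0%R, K]%classic : set R).

Variable f : R -> R.
Hypotheses (mf : measurable_fun setT f) (f0 : forall x, 0 <= f x).

Let Jn (n : nat) w := \int[M w]_(t in window n%:R) clamp n%:R (f t).

Let JnI w : (Jn n w)%:E @[n --> \oo] --> stieltjes_integral HS f w.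
Proof.
apply: (@cvg_Rintegral_window _ (M w) _ id f) => //.
- by move=> n; exact: stieltjes_measure_fin.
- by move=> n; exact: (measurableT_comp (measurable_clamp n%:R)).
Qed.

Let mJn n : measurable_fun setT (Jn n).
Proof. by case: (laplace_formula_clamp HS Hphi n (ler0n R n) mf). Qed.

Lemma stieltjes_integral_ge0 w : (0 <= stieltjes_integral HS f w)%E.
Proof. by apply: integral_ge0 => t _; rewrite lee_fin. Qed.

Lemma measurable_stieltjes_integral :
  measurable_fun setT (stieltjes_integral HS f).
Proof.
apply: (@emeasurable_fun_cvg _ _ _ _ (fun n w => (Jn n w)%:E)).
  by move=> n; exact/measurable_EFinP.
by move=> w _; exact: JnI.
Qed.

Let expJn w : expR (- Jn n w) @[n --> \oo] --> expeN (stieltjes_integral HS f w).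
Proof. by apply: cvg_expeN; [exact: stieltjes_integral_ge0|exact: JnI]. Qed.

Let mexpJn n : measurable_fun setT (fun w => expR (- Jn n w)).
Proof. by apply: measurableT_comp => //; exact: measurableT_comp. Qed.

Lemma measurable_expeN_integral :
  measurable_fun setT (fun w => expeN (stieltjes_integral HS f w)).
Proof. by apply: (measurable_fun_cvg mexpJn) => w _; exact: expJn. Qed.

Lemma expeN_integral_itv w : 0 <= expeN (stieltjes_integral HS f w) <= 1.
Proof.
rewrite expeN_ge0/=; have := stieltjes_integral_ge0 w.
case: stieltjes_integral => //= r; rewrite lee_fin => r0.
by rewrite -expR0 ler_expR oppr_le0.
Qed.

Theorem laplace_stieltjes_integral :
  \int[P]_w expeN (stieltjes_integral HS f w) =
  expeN (\int[lambda]_(t in `]0%R, +oo[) (phi (f t))%:E)%E.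
Proof.
have lhs : \int[P]_w expR (- Jn n w) @[n --> \oo] -->
    \int[P]_w expeN (stieltjes_integral HS f w).
  apply: (@bounded_cvg_Rintegral _ _ _ P setT _ _ _ _ 1) => //.
  - exact: probability_fin.
  - move=> n w _; rewrite ger0_norm ?expR_ge0// -expR0 ler_expR oppr_le0.
    by apply: Rintegral_ge0 => t _; case/andP: (clamp_itv (f t) (ler0n R n)).
have rhs : expR (- \int[lambda]_(t in window n%:R) phi (clamp n%:R (f t)))
    @[n --> \oo] --> expeN (\int[lambda]_(t in `]0%R, +oo[) (phi (f t))%:E)%E.
  apply: cvg_expeN.
    by apply: integral_ge0 => t _; rewrite lee_fin (phi_ge0 HS Hphi).
  apply: cvg_Rintegral_window => //.
  - by move=> n; rewrite [X in (X < _)%E]lebesgue_measure_oc// ltry.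
  - by move=> x y; exact: (phi_nondecreasing HS Hphi).
  - by move=> x; exact: (phi_ge0 HS Hphi).
  - move=> n; apply: (measurable_phi HS Hphi).
      exact: (measurableT_comp (measurable_clamp n%:R)).
    by move=> x; case/andP: (clamp_itv (f x) (ler0n R n)).
have lrE : (fun n => \int[P]_w expR (- Jn n w)) =
    (fun n => expR (- \int[lambda]_(t in window n%:R) phi (clamp n%:R (f t)))).
  by apply/funext => n; case: (laplace_formula_clamp HS Hphi n (ler0n R n) mf).
by move: rhs; rewrite -lrE; exact: cvg_unique lhs.
Qed.

End laplace_functional_integral.

(** * The zero-one law *)

Section zero_one.
Context (d : measure_display) (T : measurableType d) (R : realType).
Context (P : probability T R) (S : R -> {RV P >-> R}).
Hypothesis HS : subordinator S.
Context (phi : R -> R).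
Hypothesis Hphi : bernstein_function_of S phi.
Variable f : R -> R.
Hypotheses (mf : measurable_fun setT f) (f0 : forall x, 0 <= f x).

Local Notation lambda := (@lebesgue_measure R).
Local Notation I := (stieltjes_integral HS f).
Local Notation phiI := (\int[lambda]_(t in `]0%R, +oo[) (phi (f t))%:E)%E.
Local Notation finite_event := [set w | (I w < +oo)%E].

Lemma measurable_finite_event : measurable finite_event.
Proof.
rewrite -[X in measurable X]setTI.
apply: emeasurable_fun_infty_o => //.
exact: (measurable_stieltjes_integral HS Hphi mf f0).
Qed.

(** A nonnegative variable of zero mean vanishes almost surely, and [expeN]
vanishes only at [+oo] on [0, +oo]. *)
Lemma finite_event_gt0 : (0 < P finite_event)%E -> (phiI < +oo)%E.
Proof.
move=> PA; rewrite ltey; apply/negP => /eqP phioo.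
have := laplace_stieltjes_integral HS Hphi mf f0; rewrite phioo /= => E0.
have mE := measurable_expeN_integral HS Hphi mf f0.
have : (\int[P]_w `|(expeN (I w))%:E| = 0)%E.
  under eq_integral do rewrite gee0_abs ?lee_fin ?expeN_ge0//.
  rewrite -[LHS]fineK; first by rewrite -[fine _]/(Rintegral _ _ _) E0.
  apply: integral_unit_fin_num => // w; exact: expeN_integral_itv.
case/(ae_eq_integral_abs P measurableT); first exact/measurable_EFinP.
move=> N [mN PN0 subN].
suff : (P finite_event <= 0)%E by rewrite leNgt PA.
rewrite -PN0; apply: le_measure; rewrite ?inE//.
  exact: measurable_finite_event.
move=> w /= Iw; apply: subN => /= /(_ Logic.I) [].
have := stieltjes_integral_ge0 HS f0 w; case: (I w) Iw => //= r _ _ /eqP.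
by rewrite gt_eqF// expR_gt0.
Qed.

(** The event does not change when [f] is divided by [k + 1], whereas the integral
of [phi] then tends to [0]. *)
Lemma finite_event_eq1 : (phiI < +oo)%E -> P finite_event = 1%E.
Proof.
move=> phifin.
pose fk k t := k.+1%:R^-1 * f t.
have k0 k : 0 <= k.+1%:R^-1 :> R by rewrite invr_ge0.
have fk0 k x : 0 <= fk k x by rewrite mulr_ge0.
have mfk k : measurable_fun setT (fk k) by exact: measurable_funM.
pose A k := (\int[lambda]_(t in `]0%R, +oo[) (phi (fk k t))%:E)%E.
have mphi (g : R -> R) : measurable_fun setT g -> (forall x, 0 <= g x) ->
    measurable_fun setT (fun t => (phi (g t))%:E).
  by move=> mg g0; apply/measurable_EFinP; exact: (measurable_phi HS Hphi).
have Acvg : A k @[k --> \oo] --> 0%E.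
  have [] := @dominated_convergence _ _ _ lambda `]0%R, +oo[%classic _
    (fun k t => (phi (fk k t))%:E) (cst 0%E) (fun t => (phi (f t))%:E).
  - by [].
  - by move=> k; apply: measurable_funTS; exact: mphi.
  - by [].
  - apply: aeW => t _; apply: cvg_EFin; first exact: nearW.
    rewrite /= -(bernstein_at0 Hphi); apply: (phi_cvg HS Hphi) => //.
    rewrite -[X in _ --> X](mul0r (f t)); apply: cvgM; last exact: cvg_cst.
    exact: cvg_harmonic.
  - apply/integrableP; split; first by apply: measurable_funTS; exact: mphi.
    under eq_integral do rewrite gee0_abs ?lee_fin ?(phi_ge0 HS Hphi)//.
    exact: phifin.
  - apply: aeW => t k _; rewrite gee0_abs ?lee_fin ?(phi_ge0 HS Hphi)//.
    apply: (phi_nondecreasing HS Hphi) => //.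
    by rewrite /fk ler_piMl// invf_le1 ?ltr0n// ler1n.
  by move=> _ _; rewrite integral0.
have mA := measurable_finite_event.
have PA k : ((expeN (A k))%:E <= P finite_event)%E.
  have mE := measurable_expeN_integral HS Hphi (mfk k) (fk0 k).
  have E01 := expeN_integral_itv HS (fk0 k).
  rewrite -(laplace_stieltjes_integral HS Hphi (mfk k) (fk0 k)).
  rewrite /Rintegral fineK; last exact: integral_unit_fin_num.
  rewrite -[X in P X]setIT -integral_indic//.
  apply: ge0_le_integral => //.
  - by move=> w _; rewrite lee_fin expeN_ge0.
  - exact/measurable_EFinP.
  - by apply/measurable_EFinP; exact: measurable_indic.
  move=> w _; rewrite lee_fin indicE; have [wA|wA] := boolP (w \in finite_event).
    by case/andP: (E01 w).
  have Iw : I w = +oo%E.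
    apply/eqP; rewrite -leye_eq leNgt; apply: contraNN wA => Iw.
    by rewrite inE.
  rewrite (_ : stieltjes_integral HS (fk k) w = +oo%E)//.
  rewrite /stieltjes_integral /fk; under eq_integral do rewrite EFinM.
  rewrite ge0_integralZl_EFin//.
  - by rewrite [X in (_ * X)%E]Iw gt0_muley// lte_fin invr_gt0.
  - by move=> t _; rewrite lee_fin.
  - by apply: measurable_funTS; exact/measurable_EFinP.
apply/eqP; rewrite eq_le probability_le1//=.
have /fine_cvgP[Afin fA] := Acvg.
have Ecvg : (expR (- fine (A k)))%:E @[k --> \oo] --> 1%E.
  apply: cvg_EFin; first exact: nearW.
  rewrite /= -(@expR0 R) -[X in expR X]oppr0.
  by apply: continuous_cvg; [exact: continuous_expR|exact: cvgN].
rewrite -(cvg_lim _ Ecvg)//; apply: lime_le; first exact: cvgP Ecvg.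
near=> k; apply: le_trans (PA k); rewrite lee_fin.
have : A k \is a fin_num by near: k; exact: Afin.
by case: (A k).
Unshelve. all: by end_near. Qed.

End zero_one.

Theorem proposition2p3 (d : measure_display) (T : measurableType d)
    (R : realType) (P : probability T R) (S : R -> {RV P >-> R})
    (HS : subordinator S) (phi : R -> R)
    (Hphi : bernstein_function_of S phi) (f : R -> R)
    (f_meas : measurable_fun (`]0, +oo[ : set R) f)
    (f_ge0 : forall t, 0 < t -> 0 <= f t) :
  ((0 < P [set w | stieltjes_integral HS f w < +oo])%E <->
   (P [set w | stieltjes_integral HS f w < +oo] = 1)%E) /\
  ((P [set w | stieltjes_integral HS f w < +oo] = 1)%E <->
   (\int[lebesgue_measure]_(t in `]0%R, +oo[) (phi (f t))%:E < +oo)%E).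
Proof.
(* [f] is only measurable and nonnegative on the positive half-line *)
pose g : R -> R := f \_ (`]0, +oo[%classic : set R).
have gf t : t \in `]0, +oo[%classic -> g t = f t by move=> t0; rewrite /g patchE t0.
have g0 t : 0 <= g t.
  rewrite /g patchE; case: ifPn => // t0; apply: f_ge0.
  by move: t0; rewrite inE/= in_itv/= andbT.
have mg : measurable_fun setT g by exact/(measurable_restrictT _ _).1.
have -> : stieltjes_integral HS f = stieltjes_integral HS g.
  by apply/funext => w; apply: eq_integral => t t0; rewrite gf.
have -> : (\int[lebesgue_measure]_(t in `]0%R, +oo[) (phi (f t))%:E =
    \int[lebesgue_measure]_(t in `]0%R, +oo[) (phi (g t))%:E)%E.
  by apply: eq_integral => t t0; rewrite gf.
have i_iii := finite_event_gt0 (HS := HS) Hphi mg g0.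
have iii_ii := finite_event_eq1 HS Hphi mg g0.
have ii_i : (P [set w | stieltjes_integral HS g w < +oo] = 1)%E ->
    (0 < P [set w | stieltjes_integral HS g w < +oo])%E by move=> ->.
split; split => //; first by move=> /i_iii/iii_ii.
by move=> /ii_i/i_iii.
Qed.
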